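(* Let $0<c<1$ and let $\boldsymbol{p}_1:\Delta\to\mathbb{R}^3$ be the cubic triangular patch described in the context with parameters $$\alpha=\frac{8-3c^2}{3(4-3c^2)},\qquad \beta=\frac{4}{3(4-3c^2)},\qquad \gamma=\frac{\sqrt{1-c^2}\,(8-8c^2+3c^4)}{2(1-c^2)(4-3c^2)}.$$ Let $R$ be the reflection of $\mathbb{R}^3$ over the plane through the origin, $\boldsymbol{v}_1$ and $\boldsymbol{v}_2$, and let $\boldsymbol{p}_2=R\,\boldsymbol{p}_1$. Then $\boldsymbol{p}_1$ and $\boldsymbol{p}_2$, which share the boundary curve $v\mapsto\boldsymbol{p}_1(0,v)=\boldsymbol{p}_2(0,v)$, $v\in[0,1]$, form a $G^2$ continuous spline patch.
   Context: $\Delta=\{(u,v)\in\mathbb{R}^2:\ 0\le u,v\le 1,\ v\le 1-u\}$. For $0<c<1$ let $\boldsymbol{v}_0=(c,0,\sqrt{1-c^2})^T$, $\boldsymbol{v}_1=(-\tfrac12c,\tfrac{\sqrt3}{2}c,\sqrt{1-c^2})^T$, $\boldsymbol{v}_2=(-\tfrac12c,-\tfrac{\sqrt3}{2}c,\sqrt{1-c^2})^T$. The cubic patch with parameters $\alpha,\beta,\gamma$ is $\boldsymbol{p}(u,v)=\sum_{i+j+k=3}\frac{3!}{i!j!k!}u^iv^j(1-u-v)^k\,\boldsymbol{b}_{i,j,k}$ (with $i,j,k$ nonnegative integers) with control points $\boldsymbol{b}_{3,0,0}=\boldsymbol{v}_0$, $\boldsymbol{b}_{0,3,0}=\boldsymbol{v}_1$,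 $\boldsymbol{b}_{0,0,3}=\boldsymbol{v}_2$, $\boldsymbol{b}_{2,1,0}=\alpha\boldsymbol{v}_0+\beta\boldsymbol{v}_1$, $\boldsymbol{b}_{2,0,1}=\alpha\boldsymbol{v}_0+\beta\boldsymbol{v}_2$, $\boldsymbol{b}_{1,2,0}=\alpha\boldsymbol{v}_1+\beta\boldsymbol{v}_0$, $\boldsymbol{b}_{0,2,1}=\alpha\boldsymbol{v}_1+\beta\boldsymbol{v}_2$, $\boldsymbol{b}_{1,0,2}=\alpha\boldsymbol{v}_2+\beta\boldsymbol{v}_0$, $\boldsymbol{b}_{0,1,2}=\alpha\boldsymbol{v}_2+\beta\boldsymbol{v}_1$, $\boldsymbol{b}_{1,1,1}=(0,0,\gamma)^T$. $G^k$ continuity: a map $\boldsymbol{q}:D\to\mathbb{R}^3$ on an open set $D\subset\mathbb{R}^2$ is $G^k$ continuous if for each $\boldsymbol{x}\in D$ there are an open neighbourhood $D_{\boldsymbol{x}}\subseteq D$ of $\boldsymbol{x}$ and a homeomorphism $\boldsymbol{\rho}_{\boldsymbol{x}}:B^2\to D_{\boldsymbol{x}}$ from an open ball $B^2\subset\mathbb{R}^2$ such that $\boldsymbol{q}\circ\boldsymbol{\rho}_{\boldsymbol{x}}$ is $C^k$ and regular (its differential has rank $2$ everywhere). Two polynomial patches $\boldsymbol{p}_1,\boldsymbol{p}_2$ on $\Delta$ with $\boldsymbol{p}_1(0,v)=\boldsymbol{p}_2(0,v)$ form a $G^k$ continuous spline patch if, on some open neighbourhood of $\Delta_1\cup\Delta_2$,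 where $\Delta_1=\Delta$ and $\Delta_2=\{(-u,v):(u,v)\in\Delta\}$, the map $\boldsymbol{q}$ given by $\boldsymbol{q}(u,v)=\boldsymbol{p}_1(u,v)$ for $u\ge0$ and $\boldsymbol{q}(u,v)=\boldsymbol{p}_2(-u,v)$ for $u<0$ (the polynomials being extended by their formulas) is $G^k$ continuous. *)

(* Defs.v *)
From HB Require Import structures.
From mathcomp Require Import all_boot all_order all_algebra.
From mathcomp Require Import all_classical all_reals all_analysis.
Set Implicit Arguments.
Unset Strict Implicit.
Unset Printing Implicit Defensive.
Import Order.TTheory GRing.Theory Num.Theory.
Import numFieldNormedType.Exports.
Local Open Scope classical_set_scope.
Local Open Scope ring_scope.

Definition vec2 (R : realType) (u v : R) : 'rV[R]_2 :=
  \row_(i < 2) nth 0 [:: u; v] i.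

Definition vec3 (R : realType) (x y z : R) : 'rV[R]_3 :=
  \row_(i < 3) nth 0 [:: x; y; z] i.

Definition dot (R : realType) (n : nat) (a b : 'rV[R]_n) : R :=
  \sum_(i < n) a 0 i * b 0 i.

Definition cross (R : realType) (a b : 'rV[R]_3) : 'rV[R]_3 :=
  vec3 (a 0 1 * b 0 2 - a 0 2 * b 0 1)
       (a 0 2 * b 0 0 - a 0 0 * b 0 2)
       (a 0 0 * b 0 1 - a 0 1 * b 0 0).

(* [a] and [b] are meant to be linearly independent, so that the plane through
   0, [a] and [b] has the nonzero normal [cross a b]. *)
Definition plane_reflection (R : realType) (a b x : 'rV[R]_3) : 'rV[R]_3 :=
  let n := cross a b in x - (2 * dot x n / dot n n) *: n.

(* The norm of ['rV[R]_n] in the library is the sup norm; the balls below are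
   the Euclidean ones. *)
Definition open_ball (R : realType) (n : nat) (a : 'rV[R]_n) (r : R) :
    set 'rV[R]_n :=
  [set x | Num.sqrt (dot (x - a) (x - a)) < r].

Definition homeomorphism (T U : topologicalType) (A : set T) (B : set U)
    (f : T -> U) : Prop :=
  exists g : U -> T,
    [/\ set_fun A B f /\ set_fun B A g,
        {in A, cancel f g} /\ {in B, cancel g f},
        {within A, continuous f} & {within B, continuous g}].

(* Partial derivatives up to order [k] exist and are continuous on [D], which
   is meant to be open. *)
Fixpoint Ck (R : realType) (m n k : nat) (D : set 'rV[R]_m.+1)
    (f : 'rV[R]_m.+1 -> 'rV[R]_n.+1) : Prop :=
  (forall x, D x -> {for x, continuous f}) /\
  (if k is k'.+1 then
     forall i : 'I_m.+1,
       (forall x, D x -> derivable f x (delta_mx 0 i)) /\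
       Ck k' D (fun x => 'D_(delta_mx 0 i) f x)
   else True).

Definition regular (R : realType) (D : set 'rV[R]_2)
    (f : 'rV[R]_2 -> 'rV[R]_3) : Prop :=
  forall x, D x -> differentiable f x /\ \rank ('J f x) = 2%N.

Definition Gk (R : realType) (k : nat) (D : set 'rV[R]_2)
    (q : 'rV[R]_2 -> 'rV[R]_3) : Prop :=
  forall x, D x ->
    exists (Dx : set 'rV[R]_2) (a : 'rV[R]_2) (r : R)
           (rho : 'rV[R]_2 -> 'rV[R]_2),
      [/\ [/\ open Dx, Dx x & Dx `<=` D],
          0 < r,
          homeomorphism (open_ball a r) Dx rho,
          Ck k (open_ball a r) (q \o rho) &
          regular (open_ball a r) (q \o rho)].

Definition triangle (R : realType) : set 'rV[R]_2 :=
  [set x | [/\ 0 <= x 0 0 <= 1, 0 <= x 0 1 <= 1 & x 0 1 <= 1 - x 0 0]].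

Definition flip (R : realType) (x : 'rV[R]_2) : 'rV[R]_2 :=
  vec2 (- x 0 0) (x 0 1).

(* Patches are polynomial maps given on the whole parameter plane, so that
   their values outside the triangle are those of their formulas. *)
Definition glue_patches (R : realType) (p1 p2 : 'rV[R]_2 -> 'rV[R]_3)
    (x : 'rV[R]_2) : 'rV[R]_3 :=
  if 0 <= x 0 0 then p1 x else p2 (flip x).

Definition Gk_spline_patch (R : realType) (k : nat)
    (p1 p2 : 'rV[R]_2 -> 'rV[R]_3) : Prop :=
  (forall v : R, 0 <= v <= 1 -> p1 (vec2 0 v) = p2 (vec2 0 v)) /\
  exists D : set 'rV[R]_2,
    [/\ open D,
        @triangle R `|` @flip R @` @triangle R `<=` D &
        Gk k D (glue_patches p1 p2)].

Definition vtx0 (R : realType) (c : R) : 'rV[R]_3 :=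
  vec3 c 0 (Num.sqrt (1 - c ^+ 2)).
Definition vtx1 (R : realType) (c : R) : 'rV[R]_3 :=
  vec3 (- (1 / 2 * c)) (Num.sqrt 3 / 2 * c) (Num.sqrt (1 - c ^+ 2)).
Definition vtx2 (R : realType) (c : R) : 'rV[R]_3 :=
  vec3 (- (1 / 2 * c)) (- (Num.sqrt 3 / 2 * c)) (Num.sqrt (1 - c ^+ 2)).

(* Only the ten triples with sum 3 are used. *)
Definition ctrl (R : realType) (c alpha beta gamma : R) (i j k : nat) :
    'rV[R]_3 :=
  match i, j, k with
  | 3%N, 0%N, 0%N => vtx0 c
  | 0%N, 3%N, 0%N => vtx1 c
  | 0%N, 0%N, 3%N => vtx2 c
  | 2%N, 1%N, 0%N => alpha *: vtx0 c + beta *: vtx1 c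
  | 2%N, 0%N, 1%N => alpha *: vtx0 c + beta *: vtx2 c
  | 1%N, 2%N, 0%N => alpha *: vtx1 c + beta *: vtx0 c
  | 0%N, 2%N, 1%N => alpha *: vtx1 c + beta *: vtx2 c
  | 1%N, 0%N, 2%N => alpha *: vtx2 c + beta *: vtx0 c
  | 0%N, 1%N, 2%N => alpha *: vtx2 c + beta *: vtx1 c
  | 1%N, 1%N, 1%N => vec3 0 0 gamma
  | _, _, _ => 0
  end.

Definition cubic_patch (R : realType) (c alpha beta gamma : R)
    (x : 'rV[R]_2) : 'rV[R]_3 :=
  let u := x 0 0 in
  let v := x 0 1 in
  \sum_(i < 4) \sum_(j < 4) \sum_(k < 4 | (i + j + k == 3)%N)
    (3`!%:R / (i`! * j`! * k`!)%:R * u ^+ i * v ^+ j * (1 - u - v) ^+ k)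
      *: ctrl c alpha beta gamma i j k.

(* Main.v *)
(* The mirror plane contains the common edge, and along the edge the tangent
   plane of the patch is orthogonal to it: the derivative of p1 at (0, t) in the
   direction (K, 3 c^2 - 2 - 3 c^2 t), K = 4 - 3 c^2, is normal to the mirror.
   Hence, on these transversal lines, the in-plane coordinates have no linear
   term, and a quadratic change of the transversal parameter s removes the
   quadratic term of the distance to the mirror. The in-plane coordinates extend
   evenly and the distance oddly, so that the glued map becomes polynomial in s,
   t and |s|^3, hence C^2. The change of parameters is only piecewise smooth, but
   its inverse is explicit, so it is a homeomorphism.

   Away from the edge no reparametrization is needed: the first two components
   of the patch are quadratic, with Jacobian determinant a positive multiple of
   4 (1 - c^2) + 3 c^4 (u v + v w + w u), w = 1 - u - v, which is positive on the
   triangle; its positivity defines the domain on which the glued map is G^2. *)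
Require Import Defs.
From HB Require Import structures.
From mathcomp Require Import all_boot all_order all_algebra.
From mathcomp Require Import all_classical all_reals all_analysis.
From mathcomp Require Import ring lra.
Import Order.TTheory GRing.Theory Num.Theory.
Import numFieldNormedType.Exports.
Local Open Scope classical_set_scope.
Local Open Scope ring_scope.

(** * Piecewise polynomial functions *)

Lemma is_derive_chain (R : realType) (V : normedModType R) (f : V -> R)
    (g : R -> R) (x v : V) (d : R) :
  differentiable f x -> is_derive (f x) 1 g d ->
  differentiable (g \o f) x /\ 'D_v (g \o f) x = d * 'D_v f x.
Proof.
move=> df [dg <-].
have dg' : differentiable g (f x) by apply/derivable1_diffP.
have dgf : differentiable (g \o f) x by exact: differentiable_comp.
split => //; rewrite !deriveE// diff_comp//=.
have -> : 'd f x v = 'd f x v *: (1 : R) by rewrite /GRing.scale/= mulr1.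
by rewrite linearZ /= /GRing.scale/= mulrC mulr1.
Qed.

Lemma is_derive_mul_norm (R : realType) (y : R) :
  is_derive y 1 (fun z : R => z * `|z|) (2 * `|y|).
Proof.
have [y0|y0|->] := ltrgtP y 0.
- have E : {near y, (fun z : R => - (z * z)) =1 (fun z => z * `|z|)}.
    near=> z; have z0 : z < 0 by near: z; exact: lt_nbhsl.
    by rewrite ltr0_norm// mulrN.
  apply: (@near_eq_is_derive _ R^o R^o _ _ _ _ _ E); apply: is_derive_eq.
  by rewrite /GRing.scale/= ltr0_norm//; ring.
- have E : {near y, (fun z : R => z * z) =1 (fun z => z * `|z|)}.
    near=> z; have z0 : 0 < z by near: z; exact: lt_nbhsr.
    by rewrite gtr0_norm.
  apply: (@near_eq_is_derive _ R^o R^o _ _ _ _ _ E); apply: is_derive_eq.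
  by rewrite /GRing.scale/= gtr0_norm//; ring.
(* At 0 the difference quotient is [|h|], which tends to 0. *)
- suff H : h^-1 *: (((fun z : R => z * `|z|) \o shift 0) (h *: 1)
       - 0 * `|0 : R|) @[h --> 0^'] --> (2 * `|0 : R|).
    apply: DeriveDef; first by apply/cvg_ex; eexists; exact: H.
    by apply: cvg_lim => //; exact: H.
  rewrite normr0 !mulr0.
  apply/cvgr0Pnorm_lt => e e0; near=> h.
  have h0 : h != 0 by near: h; exact: nbhs_dnbhs_neq.
  rewrite /GRing.scale/= mulr1 addr0 subr0 mulrA mulVf// mul1r normr_id.
  by near: h; exact: dnbhs0_lt.
Unshelve. all: by end_near.
Qed.

Lemma is_derive_expr_norm (R : realType) (n : nat) (y : R) :
  is_derive y 1 (fun z : R => z ^+ n.+1 * `|z|) (n.+2%:R * (y ^+ n * `|y|)).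
Proof.
elim: n => [|n IH].
  by rewrite expr0 mul1r; under eq_fun do rewrite expr1; exact: is_derive_mul_norm.
have -> : (fun z : R => z ^+ n.+2 * `|z|) = id * (fun z => z ^+ n.+1 * `|z|).
  by apply/funext => z; rewrite exprS -mulrA.
by apply: is_derive_eq; rewrite /GRing.scale/= -!natr1 !exprS; ring.
Qed.

(* Polynomial expressions in the two coordinates [s], [t] and in the functions
   [PA n], which stands for [s ^+ n * `|s|] and is of class C^n. *)
Inductive pexpr (R : Type) :=
  | PC of R
  | PV of 'I_2
  | PA of nat
  | PAdd of pexpr R & pexpr R
  | PMul of pexpr R & pexpr R.

Arguments PC {R} _%_R.
Arguments PV {R}.
Arguments PA {R}.
Arguments PAdd {R}.
Arguments PMul {R}.

Fixpoint peval {R : realType} (e : pexpr R) (x : 'rV[R]_2) : R :=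
  match e with
  | PC a => a
  | PV i => x 0 i
  | PA n => x 0 0 ^+ n * `|x 0 0|
  | PAdd a b => peval a x + peval b x
  | PMul a b => peval a x * peval b x
  end.

(** Since [s ^+ n * |s|] is [s ^+ n.+1] up to sign on each side of 0, its derivative is [n.+1] times
    [s ^+ n.-1 * |s|]. For [n = 0] the value is a mere default; [psmooth 1] excludes that case. *)
Fixpoint pder {R : realType} (i : 'I_2) (e : pexpr R) : pexpr R :=
  match e with
  | PC _ => PC 0
  | PV j => PC (i == j)%:R
  | PA n => if i == 0 then PMul (PC n.+1%:R) (PA n.-1) else PC 0
  | PAdd a b => PAdd (pder i a) (pder i b)
  | PMul a b => PAdd (PMul a (pder i b)) (PMul b (pder i a))
  end.

Fixpoint psmooth {R : Type} (k : nat) (e : pexpr R) : bool :=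
  match e with
  | PA n => (k <= n)%N
  | PAdd a b | PMul a b => psmooth k a && psmooth k b
  | _ => true
  end.

Lemma psmooth_le {R : Type} (k l : nat) (e : pexpr R) :
  (k <= l)%N -> psmooth l e -> psmooth k e.
Proof.
move=> kl; elim: e => //= [n|a IHa b IHb|a IHa b IHb]; first exact: leq_trans.
  by move=> /andP[/IHa -> /IHb ->].
by move=> /andP[/IHa -> /IHb ->].
Qed.

Lemma psmooth_pder {R : realType} (k : nat) (i : 'I_2) (e : pexpr R) :
  psmooth k.+1 e -> psmooth k (pder i e).
Proof.
elim: e => //= [n kn|a IHa b IHb /andP[/IHa -> /IHb ->]//|a IHa b IHb].
  by case: ifP => //= _; rewrite -ltnS prednK// (leq_trans _ kn).
move=> /andP[ha hb].
by rewrite IHa// IHb// !(psmooth_le _ _ _ (leqnSn k)).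
Qed.

Lemma peval_continuous {R : realType} (e : pexpr R) (x : 'rV[R]_2) :
  {for x, continuous (peval e)}.
Proof.
elim: e => /= [a|i|n|a IHa b IHb|a IHa b IHb].
- exact: (@cst_continuous _ _ (a : R) x).
- exact: coord_continuous.
- have c0 := @coord_continuous R 1 2 0 0 x.
  have cX : {for x, continuous (fun y : 'rV[R]_2 => y 0 0 ^+ n)}.
    exact: (@continuous_comp _ _ _ (fun y : 'rV[R]_2 => y 0 0) (fun z => z ^+ n)
      x c0 (@exprn_continuous R n _)).
  have cN : {for x, continuous (fun y : 'rV[R]_2 => `|y 0 0|)}.
    exact: (@continuous_comp _ _ _ (fun y : 'rV[R]_2 => y 0 0) Num.norm
      x c0 (@norm_continuous R R^o _)).
  exact: continuousM cX cN.
- exact: continuousD IHa IHb.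
- exact: continuousM IHa IHb.
Qed.

Lemma peval_derive {R : realType} (e : pexpr R) (x : 'rV[R]_2) :
  psmooth 1 e ->
  differentiable (peval e) x /\
  forall i, 'D_(delta_mx 0 i) (peval e) x = peval (pder i e) x.
Proof.
(* The partial derivatives of the coordinates are read off the derivative of the identity. *)
have Dcoord (i j : 'I_2) :
    'D_(delta_mx 0 i) (fun y : 'rV[R]_2 => y 0 j) x = (i == j)%:R.
  have /matrixP/(_ 0 j) := derive_mx (@derivable_id _ _ x (delta_mx 0 i)).
  by rewrite derive_id !mxE eqxx eq_sym => ->.
elim: e => [a|j|n|a IHa b IHb|a IHa b IHb] /=.
- by move=> _; split=> // i; rewrite derive_cst.
- by move=> _; split=> [|i]; [exact: differentiable_coord | exact: Dcoord].
(* Smoothness of order one rules out [|s|] itself. *)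
- case: n => // n _.
  have dc := differentiable_coord x 0 0.
  have [dn en] : differentiable (fun y : 'rV[R]_2 => y 0 0 ^+ n.+1 * `|y 0 0|) x
      /\ forall i : 'I_2, 'D_(delta_mx 0 i)
        (fun y : 'rV[R]_2 => y 0 0 ^+ n.+1 * `|y 0 0|) x
        = n.+2%:R * (x 0 0 ^+ n * `|x 0 0|) * (i == 0)%:R.
    split=> [|i].
      by have [] := is_derive_chain _ _ _ _ _ 0 _ dc (is_derive_expr_norm R n _).
    have [_] := is_derive_chain _ _ _ _ _ (delta_mx 0 i) _ dc
      (is_derive_expr_norm R n _).
    by rewrite Dcoord.
  split=> // i; rewrite en; case: ifP => _ /=; ring.
- move=> /andP[/IHa[da ea] /IHb[db eb]]; split; first exact: differentiableD.
  by move=> i; rewrite deriveD ?ea ?eb//; exact: diff_derivable.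
- move=> /andP[/IHa[da ea] /IHb[db eb]]; split; first exact: differentiableM.
  by move=> i; rewrite deriveM ?ea ?eb//; exact: diff_derivable.
Qed.

(** * Vectors in coordinates and maps with piecewise polynomial components *)

Lemma vec3_eta (R : realType) (a : 'rV[R]_3) : vec3 (a 0 0) (a 0 1) (a 0 2) = a.
Proof.
apply/rowP => i; rewrite !mxE; case: i => [[|[|[|i]]] Hi] //=;
  by congr (a _ _); apply/val_inj.
Qed.

Lemma vec3_delta (R : realType) (a b c : R) :
  vec3 a b c = a *: delta_mx 0 0 + (b *: delta_mx 0 1 + c *: delta_mx 0 2).
Proof.
apply/rowP => i; rewrite !mxE; case: i => [[|[|[|i]]] Hi] //=; ring.
Qed.

Lemma vec3E (R : realType) (a b c : R) :
  (vec3 a b c 0 0 = a) * (vec3 a b c 0 1 = b) * (vec3 a b c 0 2 = c).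
Proof. by rewrite !mxE. Qed.

Lemma vec2E (R : realType) (a b : R) :
  (vec2 a b 0 0 = a) * (vec2 a b 0 1 = b).
Proof. by rewrite !mxE. Qed.

Lemma vec2_eta (R : realType) (a : 'rV[R]_2) : vec2 (a 0 0) (a 0 1) = a.
Proof.
apply/rowP => i; rewrite !mxE; case: i => [[|[|i]] Hi] //=;
  by congr (a _ _); apply/val_inj.
Qed.

Lemma vec2_delta (R : realType) (a b : R) :
  vec2 a b = a *: delta_mx 0 0 + b *: delta_mx 0 1.
Proof.
apply/rowP => i; rewrite !mxE; case: i => [[|[|i]] Hi] //=; ring.
Qed.

Lemma vec2_continuous (T : topologicalType) (R : realType) (f g : T -> R) (x : T) :
  {for x, continuous f} -> {for x, continuous g} ->
  {for x, continuous (fun y => vec2 (f y) (g y))}.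
Proof.
move=> cf cg; rewrite (funext (fun y => vec2_delta _ (f y) (g y))).
by apply: continuousD; apply: continuousZr_tmp.
Qed.

Definition pmap3 {R : realType} (X Y Z : pexpr R) (x : 'rV[R]_2) : 'rV[R]_3 :=
  vec3 (peval X x) (peval Y x) (peval Z x).

Lemma pmap3_delta (R : realType) (X Y Z : pexpr R) :
  pmap3 X Y Z = fun x => peval X x *: delta_mx 0 0 +
    (peval Y x *: delta_mx 0 1 + peval Z x *: delta_mx 0 2).
Proof. by apply/funext => x; exact: vec3_delta. Qed.

Lemma pmap3_continuous (R : realType) (X Y Z : pexpr R) (x : 'rV[R]_2) :
  {for x, continuous (pmap3 X Y Z)}.
Proof.
rewrite pmap3_delta.
apply: continuousD; last apply: continuousD;
  by apply: continuousZr_tmp; exact: peval_continuous.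
Qed.

Lemma pmap3_derive (R : realType) (X Y Z : pexpr R) (x : 'rV[R]_2) :
  psmooth 1 X -> psmooth 1 Y -> psmooth 1 Z ->
  differentiable (pmap3 X Y Z) x /\
  forall i, 'D_(delta_mx 0 i) (pmap3 X Y Z) x =
            pmap3 (pder i X) (pder i Y) (pder i Z) x.
Proof.
move=> /(peval_derive _ x)[dX eX] /(peval_derive _ x)[dY eY].
move=> /(peval_derive _ x)[dZ eZ].
have d : differentiable (pmap3 X Y Z) x.
  rewrite pmap3_delta.
  apply: differentiableD; last apply: differentiableD;
  exact: differentiableZl.
split=> // i; rewrite derive_mx; last exact: diff_derivable.
have cX : (fun y => pmap3 X Y Z y 0 0) = peval X.
  by apply/funext => y; rewrite mxE.
have cY : (fun y => pmap3 X Y Z y 0 1) = peval Y.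
  by apply/funext => y; rewrite mxE.
have cZ : (fun y => pmap3 X Y Z y 0 2) = peval Z.
  by apply/funext => y; rewrite mxE.
by rewrite -[LHS]vec3_eta 3!mxE cX cY cZ eX eY eZ.
Qed.

(** Partial derivatives of these maps are again maps of this form, with one order of smoothness
    less, so induction on [k] applies. *)
Lemma Ck_pmap3 (R : realType) (k : nat) (D : set 'rV[R]_2) (X Y Z : pexpr R) :
  psmooth k X -> psmooth k Y -> psmooth k Z -> Ck k D (pmap3 X Y Z).
Proof.
elim: k X Y Z => [|k IH] X Y Z sX sY sZ.
  by split; [move=> x _; exact: pmap3_continuous|].
split=> [x _|i]; first exact: pmap3_continuous.
have s1 := psmooth_le _ _ _ (ltn0Sn k).
have d x := pmap3_derive R X Y Z x (s1 _ _ sX) (s1 _ _ sY) (s1 _ _ sZ).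
split=> [x _|]; first by apply: diff_derivable; have [] := d x.
rewrite (_ : (fun x => _) = pmap3 (pder i X) (pder i Y) (pder i Z)).
  by apply: IH; exact: psmooth_pder.
by apply/funext => x; have [_] := d x; exact.
Qed.

(** * Smoothness and regularity are local *)

Lemma near_eq_in (T : topologicalType) (U : Type) (D : set T) (f g : T -> U)
    (x : T) :
  open D -> {in D, f =1 g} -> D x -> \near x, f x = g x.
Proof.
move=> oD fg Dx; have : nbhs x D by apply: open_nbhs_nbhs; split.
by apply: filterS => y Dy; apply: fg; exact/mem_set.
Qed.

Lemma eq_continuous_in (T U : topologicalType) (D : set T) (f g : T -> U) (x : T) :
  open D -> {in D, f =1 g} -> D x -> {for x, continuous f} ->
  {for x, continuous g}.
Proof.
move=> oD fg Dx cf; have E := near_eq_in _ _ _ _ _ _ oD fg Dx.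
rewrite /prop_for /continuous_at -(nbhs_singleton E).
by apply: cvg_trans cf; exact: near_eq_cvg.
Qed.

(** Derivatives at a point of an open set depend only on the values in that set. This transfers
    smoothness from a closed formula to the glued map, which is defined by cases. *)
Lemma eq_Ck (R : realType) (m n k : nat) (D : set 'rV[R]_m.+1)
    (f g : 'rV[R]_m.+1 -> 'rV[R]_n.+1) :
  open D -> {in D, f =1 g} -> Ck k D f -> Ck k D g.
Proof.
move=> oD; elim: k f g => [|k IH] f g fg [cf hf].
  split; last by [].
  by move=> x Dx; exact: (eq_continuous_in _ _ _ _ _ _ oD fg Dx (cf x Dx)).
split=> [|i]; first by move=> x Dx; exact: (eq_continuous_in _ _ _ _ _ _ oD fg Dx (cf x Dx)).
have E x : D x -> \near x, f x = g x by exact: near_eq_in.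
have [df Cf] := hf i.
split=> [x Dx|]; first by apply: near_eq_derivable (E x Dx) (df x Dx).
by apply: IH Cf => x /set_mem Dx; exact: near_eq_derive (E x Dx).
Qed.

Lemma near_eq_diff (R : realType) (V W : normedModType R) (f g : V -> W) (x : V) :
  (\near x, f x = g x) -> differentiable f x ->
  differentiable g x /\ 'd g x = 'd f x :> (V -> W).
Proof.
move=> E df.
(* The first-order expansion of [f] at [x] is also one of [g]; uniqueness of the differential then
   identifies the two. *)
have H : g \o shift x = cst (g x) + 'd f x +o_ 0 id.
  apply/eqaddoP => e e0.
  have /eqaddoP/(_ e e0) := diff_locally df.
  have : \forall h \near 0, f (h + x) = g (h + x).
    by have := E; rewrite {1}(near_shift 0 x) subr0.
  apply: filterS2 => h /= fg.
  by rewrite !fctE /= fg (nbhs_singleton E).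
have dE : 'd g x = 'd f x :> (V -> W) by apply: diff_unique => //; exact: diff_continuous.
split=> //; apply/diff_locallyP; rewrite dE; split=> //.
exact: diff_continuous.
Qed.

Lemma eq_regular (R : realType) (D : set 'rV[R]_2) (f g : 'rV[R]_2 -> 'rV[R]_3) :
  open D -> {in D, f =1 g} -> regular D f -> regular D g.
Proof.
move=> oD fg rf x Dx; have [df rk] := rf x Dx.
have [dg e] := near_eq_diff _ _ _ _ _ _ (near_eq_in _ _ _ _ _ _ oD fg Dx) df.
split; first exact: dg.
have -> : 'J g x = 'J f x; last exact: rk.
apply/matrixP => i j; rewrite [LHS]mxE [RHS]mxE.
exact: (congr1 (fun h : 'rV[R]_2 -> 'rV[R]_3 => h (delta_mx 0 i) 0 j) e).
Qed.

(** * Regularity from a nonzero minor *)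

Lemma det2 (R : comRingType) (A : 'M[R]_2) :
  \det A = A 0 0 * A 1 1 - A 0 1 * A 1 0.
Proof.
have l0 : lift 0 0 = 1 :> 'I_2 by apply/val_inj.
have l1 : lift 1 0 = 0 :> 'I_2 by apply/val_inj.
rewrite (expand_det_row A 0) 2!big_ord_recl big_ord0 /cofactor !det_mx11.
by rewrite l0 !mxE l0 l1 /= expr0 expr1; ring.
Qed.

(** Multiplying the Jacobian matrix by [Q] cannot raise its rank, so an invertible product forces
    rank 2. *)
Lemma regular_pmap3_mx (R : realType) (D : set 'rV[R]_2) (X Y Z : pexpr R)
   (Q : 'M[R]_(3, 2)) :
  psmooth 1 X -> psmooth 1 Y -> psmooth 1 Z ->
  (forall x, D x -> \det ((\matrix_(i < 2)
      pmap3 (pder i X) (pder i Y) (pder i Z) x) *m Q) != 0) ->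
  regular D (pmap3 X Y Z).
Proof.
move=> sX sY sZ H x Dx.
have [d e] := pmap3_derive R X Y Z x sX sY sZ; split; first exact: d.
have -> : 'J (pmap3 X Y Z) x =
    \matrix_(i < 2) pmap3 (pder i X) (pder i Y) (pder i Z) x.
  by apply/row_matrixP => i; rewrite rowK -e (deriveEjacobian _ d) -rowE.
apply/eqP; rewrite eqn_leq rank_leq_row /=.
apply: leq_trans (mxrankM_maxl _ Q); rewrite mxrank_unit//.
by rewrite unitmxE unitfE H.
Qed.

(** The columns of [Q] are [a] and [b]: the surface is regular where its image under these two
    functionals is a regular planar map. The freedom in choosing them is used for the reflected
    patch. *)
Lemma regular_pmap3 (R : realType) (D : set 'rV[R]_2) (X Y Z : pexpr R)
   (a b : 'rV[R]_3) :
  psmooth 1 X -> psmooth 1 Y -> psmooth 1 Z ->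
  (forall x, D x -> let p i := pmap3 (pder i X) (pder i Y) (pder i Z) x in
     dot (p 0) a * dot (p 1) b - dot (p 0) b * dot (p 1) a != 0) ->
  regular D (pmap3 X Y Z).
Proof.
move=> sX sY sZ H.
apply: (regular_pmap3_mx _ _ _ _ _ (\matrix_(i, j) (if j == 0 then a 0 i else b 0 i))) => //.
move=> x /H /=; rewrite det2.
suff E i j : ((\matrix_(i < 2) pmap3 (pder i X) (pder i Y) (pder i Z) x) *m
    (\matrix_(i, j) (if j == 0 then a 0 i else b 0 i)) : 'M[R]_2) i j =
    dot (pmap3 (pder i X) (pder i Y) (pder i Z) x) (if j == 0 then a else b).
  by rewrite !E.
by rewrite mxE; apply: eq_bigr => l _; rewrite [X in X * _]mxE [X in _ * X]mxE; case: ifP.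
Qed.

(** * Local reparametrizations *)

Lemma dotE2 (R : realType) (a b : 'rV[R]_2) :
  dot a b = a 0 0 * b 0 0 + a 0 1 * b 0 1.
Proof.
rewrite /dot 2!big_ord_recl big_ord0 addr0.
by rewrite (_ : lift 0 0 = 1)//; exact: val_inj.
Qed.

Lemma dotE3 (R : realType) (a b : 'rV[R]_3) :
  dot a b = a 0 0 * b 0 0 + a 0 1 * b 0 1 + a 0 2 * b 0 2.
Proof.
rewrite /dot 3!big_ord_recl big_ord0 addr0 addrA.
have -> : lift 0 (lift 0 0) = 2 :> 'I_3 by apply/val_inj.
by have -> : lift 0 0 = 1 :> 'I_3 by apply/val_inj.
Qed.

Lemma open_ball_open (R : realType) (a : 'rV[R]_2) (r : R) : open (open_ball a r).
Proof.
pose e : pexpr R :=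
  PAdd (PMul (PAdd (PV 0) (PC (- a 0 0))) (PAdd (PV 0) (PC (- a 0 0))))
       (PMul (PAdd (PV 1) (PC (- a 0 1))) (PAdd (PV 1) (PC (- a 0 1)))).
have -> : open_ball a r = (fun x => Num.sqrt (peval e x)) @^-1` [set z | z < r].
  by apply/seteqP; split=> x; rewrite /open_ball /= dotE2 !mxE.
apply: open_comp; last exact: open_lt.
move=> x _; apply: continuous_comp; first exact: peval_continuous.
exact: sqrt_continuous.
Qed.

Lemma open_ball_center (R : realType) (n : nat) (a : 'rV[R]_n) (r : R) :
  0 < r -> open_ball a r a.
Proof.
move=> r0; rewrite /open_ball /= subrr /dot big1 ?sqrtr0// => i _.
by rewrite mxE mul0r.
Qed.

(** The sup norm is at most the Euclidean norm, so the Euclidean ball lies in the library ball of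
    the same radius. *)
Lemma open_ball_subset (R : realType) (a : 'rV[R]_2) (U : set 'rV[R]_2) :
  open U -> U a -> exists2 r, 0 < r & open_ball a r `<=` U.
Proof.
move=> oU Ua; have /nbhs_ballP[r /= r0 rU] : nbhs a U.
  by apply: open_nbhs_nbhs; split.
exists r => // x; rewrite /open_ball /= dotE2 !mxE => xr; apply: rU; split=> // i j.
rewrite /ball /= (ord1 i) distrC; apply: le_lt_trans xr.
rewrite -sqrtr_sqr ler_wsqrtr// -!expr2.
have h0 := sqr_ge0 (x 0 0 - a 0 0); have h1 := sqr_ge0 (x 0 1 - a 0 1).
have [->|->] : j = 0 \/ j = 1.
  by case: j => [[|[|j]] Hj] //; [left|right]; exact: val_inj.
- by rewrite lerDl.
- by rewrite lerDr.
Qed.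

(** The neighbourhood of [x] is the part of [W] that [g] sends into a small ball around [y] inside
    [U]; continuity of [g] makes it open. Smoothness and regularity are those of the formula [f],
    which agrees with [q \o rho] on [U]. *)
Lemma local_reparametrization (R : realType) (k : nat) (U W D : set 'rV[R]_2)
    (q f : 'rV[R]_2 -> 'rV[R]_3) (rho g : 'rV[R]_2 -> 'rV[R]_2) (x y : 'rV[R]_2) :
  open U -> open W -> U y -> rho y = x -> W `<=` D ->
  (forall z, U z -> {for z, continuous rho} /\ W (rho z) /\ g (rho z) = z) ->
  (forall z, W z -> {for z, continuous g} /\ rho (g z) = z) ->
  {in U, f =1 q \o rho} -> (forall B, Ck k B f) -> regular U f ->
  exists (Dx : set 'rV[R]_2) (a : 'rV[R]_2) (r : R)
         (rho : 'rV[R]_2 -> 'rV[R]_2),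
      [/\ [/\ open Dx, Dx x & Dx `<=` D],
          0 < r,
          homeomorphism (open_ball a r) Dx rho,
          Ck k (open_ball a r) (q \o rho) &
          regular (open_ball a r) (q \o rho)].
Proof.
move=> oU oW Uy <- WD hrho hg ff Ckf rf.
have [r r0 BU] := open_ball_subset _ _ _ oU Uy.
have oB := open_ball_open R y r.
have fB : {in open_ball y r, f =1 q \o rho}.
  by move=> z /set_mem/BU/mem_set; exact: ff.
exists (W `&` g @^-1` open_ball y r), y, r, rho; split=> //.
- split.
  + rewrite openE => z [Wz gz].
    have [cg _] := hg z Wz; apply: filterI; first by apply: open_nbhs_nbhs; split.
    by apply: cg; apply: open_nbhs_nbhs; split.
  + have [_ [Wy gy]] := hrho y Uy; split=> //=.
    by rewrite gy; exact: open_ball_center.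
  + by move=> z [/WD].
- exists g; split.
  + split=> [z Bz|z [] //]; have [_ [Wz gz]] := hrho z (BU z Bz).
    by split=> //=; rewrite gz.
  + split=> z /set_mem; first by move=> /BU/hrho[_ []].
    by move=> [/hg[]].
  + apply: continuous_in_subspaceT => z /set_mem/BU/hrho[c _]; exact: c.
  + by apply: continuous_in_subspaceT => z /set_mem[/hg[]].
- by apply: eq_Ck (Ckf (open_ball y r)).
- apply: (eq_regular _ _ f) => // z Bz; exact: rf (BU z Bz).
Qed.

(** * The patch and its reflection *)

Declare Scope pexpr_scope.
Delimit Scope pexpr_scope with pexpr.
Bind Scope pexpr_scope with pexpr.
Notation "a + b" := (PAdd a b) : pexpr_scope.
Notation "a * b" := (PMul a b) : pexpr_scope.

(* Cartesian components of the patch in the monomial basis. For the given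
   [alpha] and [beta] the cubic part of the first two components vanishes. *)
Definition patch_x {R : realType} (c : R) (u v : pexpr R) : pexpr R :=
  (PC (c / (2 * (4 - 3 * c ^+ 2))) *
   (PC (12 - 6 * c ^+ 2) * u + PC (6 * c ^+ 2) * (u * v)
    + PC (6 * c ^+ 2) * (v * v) + PC (- (6 * c ^+ 2)) * v
    + PC (- (3 * c ^+ 2)) * (u * u) + PC (3 * c ^+ 2 - 4)))%pexpr.

Definition patch_y {R : realType} (c : R) (u v : pexpr R) : pexpr R :=
  (PC (Num.sqrt 3 * c / (2 * (4 - 3 * c ^+ 2))) *
   (PC (3 * c ^+ 2) * (u * u) + PC (6 * c ^+ 2) * (u * v)
    + PC (4 - 6 * c ^+ 2) * u + PC (8 - 6 * c ^+ 2) * v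
    + PC (3 * c ^+ 2 - 4)))%pexpr.

Definition patch_z {R : realType} (c : R) (u v : pexpr R) : pexpr R :=
  (PC (Num.sqrt (1 - c ^+ 2) / ((4 - 3 * c ^+ 2) * (1 - c ^+ 2))) *
   (PC (6 * c ^+ 2 * (1 - c ^+ 2)) * (u + v + PC (- 1) * (u * u + v * v))
    + PC (15 * c ^+ 4 - 6 * c ^+ 2) * (u * v)
    + PC (- (9 * c ^+ 4)) * (u * v * (u + v))
    + PC ((1 - c ^+ 2) * (4 - 3 * c ^+ 2))))%pexpr.

Lemma cubic_patch_bernstein (R : realType) (c al be ga : R) (x : 'rV[R]_2) :
  cubic_patch c al be ga x =
  let u := x 0 0 in let v := x 0 1 in let w := 1 - u - v in
  (u ^+ 3 + 3 * u ^+ 2 * (v + w) * al + 3 * u * (v ^+ 2 + w ^+ 2) * be) *: vtx0 c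
  + (v ^+ 3 + 3 * v ^+ 2 * (u + w) * al + 3 * v * (u ^+ 2 + w ^+ 2) * be) *: vtx1 c
  + (w ^+ 3 + 3 * w ^+ 2 * (u + v) * al + 3 * w * (u ^+ 2 + v ^+ 2) * be) *: vtx2 c
  + (6 * u * v * w) *: vec3 0 0 ga.
Proof.
rewrite /cubic_patch /=; set u := x 0 0; set v := x 0 1; set w := 1 - u - v.
(* Moving the condition into the summand leaves full ranges, which unfold by computation. *)
have E1 (f : 'I_4 -> 'I_4 -> 'I_4 -> 'rV[R]_3) :
   \sum_(i < 4) \sum_(j < 4) \sum_(k < 4 | (i + j + k == 3)%N) f i j k =
   \sum_(i < 4) \sum_(j < 4) \sum_(k < 4) (if (i + j + k == 3)%N then f i j k else 0).
  by apply: eq_bigr => i _; apply: eq_bigr => j _; rewrite big_mkcond.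
rewrite E1 {E1}; do 2 rewrite !big_ord_recl !big_ord0 /= /bump /=.
rewrite !addr0 !add0r !factE !expr0 !expr1 /= ?mulr1 ?mul1r.
apply/rowP => l; rewrite !mxE.
set a := nth _ _ _; set b := nth _ _ _; set d := nth _ _ _; set e := nth _ _ _.
by field.
Qed.

Lemma sqr_lt1 (R : realType) (c : R) : 0 < c -> c < 1 -> c ^+ 2 < 1.
Proof. by move=> c0 c1; rewrite expr_lt1// ltW. Qed.

Lemma four_sub_gt0 (R : realType) (c : R) : c ^+ 2 < 1 -> 0 < 4 - 3 * c ^+ 2.
Proof. by move=> h; lra. Qed.

Lemma cubic_patchE (R : realType) (c : R) :
  0 < c -> c < 1 ->
  cubic_patch c ((8 - 3 * c ^+ 2) / (3 * (4 - 3 * c ^+ 2)))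
    (4 / (3 * (4 - 3 * c ^+ 2)))
    (Num.sqrt (1 - c ^+ 2) * (8 - 8 * c ^+ 2 + 3 * c ^+ 4)
               / (2 * (1 - c ^+ 2) * (4 - 3 * c ^+ 2))) =1
  pmap3 (patch_x c (PV 0) (PV 1)) (patch_y c (PV 0) (PV 1))
        (patch_z c (PV 0) (PV 1)).
Proof.
move=> c0 c1 x; have h := sqr_lt1 _ _ c0 c1; have K0 := four_sub_gt0 _ _ h.
rewrite cubic_patch_bernstein /=.
have K1 : 4 - 3 * c ^+ 2 != 0 by rewrite gt_eqF.
have C1 : 1 - c ^+ 2 != 0 by rewrite gt_eqF// subr_gt0.
rewrite -[LHS]vec3_eta /vtx0 /vtx1 /vtx2 /pmap3 /patch_x /patch_y /patch_z.
rewrite !(mxE _ _ 0 0) !(mxE _ _ 0 1) !(mxE _ _ 0 2) /=.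
by congr vec3; field; rewrite ?K1 ?C1 ?(mulf_neq0 K1 C1).
Qed.

(** The normal is a multiple of [(2 S, 0, c)], whose squared length is [4 S^2 + c^2 = K]. *)
Lemma plane_reflectionE (R : realType) (c : R) (p : 'rV[R]_3) :
  0 < c -> c < 1 ->
  plane_reflection (vtx1 c) (vtx2 c) p =
  let S := Num.sqrt (1 - c ^+ 2) in let K := 4 - 3 * c ^+ 2 in
  vec3 ((5 * c ^+ 2 - 4) / K * p 0 0 + - (4 * S * c / K) * p 0 2)
       (p 0 1)
       (- (4 * S * c / K) * p 0 0 + (4 - 5 * c ^+ 2) / K * p 0 2).
Proof.
move=> c0 c1 /=; set S := Num.sqrt _; set K := 4 - _.
have h := sqr_lt1 _ _ c0 c1; have K0 : 0 < K by exact: four_sub_gt0.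
have SS : S ^+ 2 = 1 - c ^+ 2 by rewrite sqr_sqrtr// subr_ge0 ltW.
have T0 : Num.sqrt 3 != 0 :> R by rewrite gt_eqF// sqrtr_gt0.
rewrite /plane_reflection /=.
have -> : cross (vtx1 c) (vtx2 c) =
    (Num.sqrt 3 * c / 2) *: vec3 (2 * S) 0 c.
  rewrite -[RHS]vec3_eta /cross /vtx1 /vtx2 !vec3E.
  rewrite !(mxE _ _ 0 0) !(mxE _ _ 0 1) !(mxE _ _ 0 2) /= -/S.
  by congr vec3; field.
set n := vec3 (2 * S) 0 c.
have nn : dot n n = K by rewrite dotE3 !vec3E /K; ring: SS.
have pn : dot p n = 2 * S * p 0 0 + c * p 0 2 by rewrite dotE3 !vec3E; ring.
set k := Num.sqrt 3 * c / 2.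
have k0 : k != 0 by rewrite /k !mulf_neq0 ?invr_eq0 ?gt_eqF.
have dotZ (a b : 'rV[R]_3) : dot a (k *: b) = k * dot a b.
  by rewrite !dotE3 !mxE; ring.
have dotZl (a b : 'rV[R]_3) : dot (k *: a) b = k * dot a b.
  by rewrite !dotE3 !mxE; ring.
have K1 : K != 0 by rewrite gt_eqF.
rewrite dotZl !dotZ nn pn scalerA.
rewrite (_ : 2 * _ / _ * k = 2 * (2 * S * p 0 0 + c * p 0 2) / K); last first.
  by field; rewrite ?K1 ?k0.
(* With [K] written in terms of [S], the only relation left is [c ^+ 2 = 1 - S ^+ 2]. *)
have KE : K = 1 + 3 * S ^+ 2 by rewrite SS /K; ring.
have cE : c ^+ 2 = 1 - S ^+ 2 by rewrite SS; ring.
rewrite -[LHS]vec3_eta !(mxE _ _ 0 0) !(mxE _ _ 0 1) !(mxE _ _ 0 2) /n /=.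
rewrite cE; move: K1; rewrite KE; clearbody S => {}K1.
by congr vec3; field: cE.
Qed.

(* Up to a positive constant, the Jacobian determinant of the first two
   components of the patch. *)
Definition gap {R : realType} (c : R) (u v : pexpr R) : pexpr R :=
  (PC (4 * (1 - c ^+ 2))
   + PC (3 * c ^+ 4) * (u * v + (u + v) * (PC 1 + PC (- 1) * (u + v))))%pexpr.

(** [PA 0] stands for [|u|]: on the left half the second patch is evaluated at the mirrored
    parameter. *)
Definition regular_domain {R : realType} (c : R) : set 'rV[R]_2 :=
  [set x | 0 < peval (gap c (PA 0) (PV 1)) x].

Definition refl_x {R : realType} (c : R) (X Z : pexpr R) : pexpr R :=
  (PC ((5 * c ^+ 2 - 4) / (4 - 3 * c ^+ 2)) * X
   + PC (- (4 * Num.sqrt (1 - c ^+ 2) * c / (4 - 3 * c ^+ 2))) * Z)%pexpr.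

Definition refl_z {R : realType} (c : R) (X Z : pexpr R) : pexpr R :=
  (PC (- (4 * Num.sqrt (1 - c ^+ 2) * c / (4 - 3 * c ^+ 2))) * X
   + PC ((4 - 5 * c ^+ 2) / (4 - 3 * c ^+ 2)) * Z)%pexpr.

Lemma peval_open_pos (R : realType) (e : pexpr R) : open [set x | 0 < peval e x].
Proof.
apply: (@open_comp _ _ (peval e) [set z | 0 < z]); last exact: open_gt.
by move=> x _; exact: peval_continuous.
Qed.

Lemma regular_domain_open (R : realType) (c : R) : open (regular_domain c).
Proof. exact: peval_open_pos. Qed.

Lemma triangle_regular_domain (R : realType) (c : R) :
  0 < c -> c < 1 ->
  @triangle R `|` @flip R @` @triangle R `<=` regular_domain c.
Proof.
move=> c0 c1; have h := sqr_lt1 _ _ c0 c1.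
suff H (x : 'rV[R]_2) : triangle x ->
    0 < peval (gap c (PV 0) (PV 1)) x.
  move=> x [tx|[y ty <-]].
    have := H x tx; case: tx => /andP[u0 _] _ _.
    by rewrite /regular_domain /= expr0 mul1r ger0_norm.
  have := H y ty; case: ty => /andP[u0 _] _ _.
  by rewrite /regular_domain /= !mxE /= expr0 mul1r normrN ger0_norm.
case=> /andP[u0 u1] /andP[v0 v1] uv /=.
(* The constant term is positive because [c < 1]; the rest is a sum of products of barycentric
   coordinates. *)
apply: ltr_wpDr; last by rewrite mulr_gt0// subr_gt0.
rewrite mulr_ge0//; first by rewrite mulr_ge0// exprn_ge0// ltW.
move: u0 v0 uv; move: (x 0 0) (x 0 1) => a b a0 b0 ab.
have w0 : 0 <= 1 + - 1 * (a + b) by lra.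
by rewrite addr_ge0 ?(mulr_ge0 _ w0) ?mulr_ge0 ?addr_ge0.
Qed.

Lemma patch_regular (R : realType) (c : R) :
  0 < c -> c < 1 ->
  regular [set x | 0 < peval (gap c (PV 0) (PV 1)) x]
    (pmap3 (patch_x c (PV 0) (PV 1)) (patch_y c (PV 0) (PV 1))
           (patch_z c (PV 0) (PV 1))).
Proof.
move=> c0 c1; have h := sqr_lt1 _ _ c0 c1; have K0 := four_sub_gt0 _ _ h.
have K1 : 4 - 3 * c ^+ 2 != 0 by rewrite gt_eqF.
apply: (regular_pmap3 _ _ _ _ _ (vec3 1 0 0) (vec3 0 1 0)) => // x /=.
set g := (X in 0 < X) => g0.
rewrite !dotE3 !vec3E !(mulr0, mulr1, addr0, add0r).
rewrite (_ : _ - _ = 6 * Num.sqrt 3 * c ^+ 2 / (4 - 3 * c ^+ 2) ^+ 2 * g).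
  by rewrite gt_eqF// mulr_gt0// divr_gt0 ?mulr_gt0 ?exprn_gt0// sqrtr_gt0.
by rewrite /g /=; field; rewrite K1.
Qed.

Lemma reflected_patch_regular (R : realType) (c : R) :
  0 < c -> c < 1 ->
  let u := (PC (- 1) * PV 0)%pexpr in let v := PV 1 in
  regular [set x | 0 < peval (gap c u v) x]
    (pmap3 (refl_x c (patch_x c u v) (patch_z c u v)) (patch_y c u v)
           (refl_z c (patch_x c u v) (patch_z c u v))).
Proof.
move=> c0 c1; have h := sqr_lt1 _ _ c0 c1; have K0 := four_sub_gt0 _ _ h.
have K1 : 4 - 3 * c ^+ 2 != 0 by rewrite gt_eqF.
have C1 : 1 - c ^+ 2 != 0 by rewrite gt_eqF// subr_gt0.
set S := Num.sqrt (1 - c ^+ 2).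
have SS : S ^+ 2 = 1 - c ^+ 2 by rewrite sqr_sqrtr// subr_ge0 ltW.
(* The two functionals are the reflections of the first two coordinates, so
   that the minor is the one of the unreflected patch. *)
apply: (regular_pmap3 _ _ _ _ _ (vec3 ((5 * c ^+ 2 - 4) / (4 - 3 * c ^+ 2)) 0
  (- (4 * S * c / (4 - 3 * c ^+ 2)))) (vec3 0 1 0)) => // x /=.
set g := (X in 0 < X) => g0.
rewrite !dotE3 !vec3E !(mulr0, mulr1, addr0, add0r).
(* The sign comes from the substitution [u = - s], which reverses orientation. *)
rewrite (_ : _ - _ = - (6 * Num.sqrt 3 * c ^+ 2 / (4 - 3 * c ^+ 2) ^+ 2 * g)).
  by rewrite oppr_eq0 gt_eqF// mulr_gt0// divr_gt0 ?mulr_gt0 ?exprn_gt0// sqrtr_gt0.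
rewrite /g /= -/S.
by field: SS; rewrite ?K1 ?C1 ?mulf_neq0.
Qed.

(** * Charts at the common edge *)

(* Write the patch as [x = c/2 x'], [z = S z'] with [S = sqrt (1 - c^2)], and put
   [K = 4 - 3 c^2], [N = (1 - c^2) (x' + z')] (a multiple of the distance to the
   mirror plane) and [T = c^2 x' - 4 (1 - c^2) z'] (a coordinate inside it).
   Along the line [u = K a], [v = t + (3 c^2 - 2 - 3 c^2 t) a], which leaves the
   edge orthogonally to the mirror plane, they expand as
   [N = 3 e1 a + 3 e2 a^2 + e3 a^3] and [T = t0 + t2 a^2 + t3 a^3]. *)
Definition edge_e1 {R : realType} (c : R) (t : pexpr R) : pexpr R :=
  (PC (4 * (1 - c ^+ 2)) + PC (3 * c ^+ 4) * (t * (PC 1 + PC (- 1) * t)))%pexpr.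

Definition edge_e2 {R : realType} (c : R) (t : pexpr R) : pexpr R :=
  (PC (c ^+ 2 * (15 * c ^+ 2 - 12))
   + PC (- (18 * c ^+ 6)) * (t * (PC 1 + PC (- 1) * t)))%pexpr.

Definition edge_e3 {R : realType} (c : R) (t : pexpr R) : pexpr R :=
  (PC (c ^+ 4 * (36 - 54 * c ^+ 2))
   + PC (81 * c ^+ 8) * (t * (PC 1 + PC (- 1) * t)))%pexpr.

Definition edge_t0 {R : realType} (c : R) (t : pexpr R) : pexpr R :=
  (PC (3 * c ^+ 2 - 4)
   + PC (- (6 * c ^+ 2)) * (t * (PC 1 + PC (- 1) * t)))%pexpr.

Definition edge_t2 {R : realType} (c : R) (t : pexpr R) : pexpr R :=
  (PC (c ^+ 2 * (72 - 72 * c ^+ 2 - 27 * c ^+ 4))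
   + PC (162 * c ^+ 6) * (t * (PC 1 + PC (- 1) * t)))%pexpr.

Definition edge_t3 {R : realType} (c : R) (t : pexpr R) : pexpr R :=
  (PC (c ^+ 4 * (216 * c ^+ 2 - 144))
   + PC (- (324 * c ^+ 8)) * (t * (PC 1 + PC (- 1) * t)))%pexpr.

(** [frame_x] and [frame_z] solve the linear equations defining [N] and [T] for the Cartesian
    components. *)
Definition frame_x {R : realType} (c : R) (N T : pexpr R) : pexpr R :=
  (PC (c / (2 * (4 - 3 * c ^+ 2))) * (PC 4 * N + T))%pexpr.

Definition frame_z {R : realType} (c : R) (N T : pexpr R) : pexpr R :=
  (PC (Num.sqrt (1 - c ^+ 2) / (4 - 3 * c ^+ 2)) *
   (PC (c ^+ 2 / (1 - c ^+ 2)) * N + PC (- 1) * T))%pexpr.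

Definition frame_y {R : realType} (c : R) (t a2 : pexpr R) : pexpr R :=
  (PC (Num.sqrt 3 * c / 2) *
   (PC 2 * t + PC (- 1) + PC (9 * c ^+ 4) * (PC 1 + PC (- 2) * t) * a2))%pexpr.

Definition edge_N {R : realType} (c : R) (t a : pexpr R) : pexpr R :=
  (PC 3 * (edge_e1 c t * a) + PC 3 * (edge_e2 c t * (a * a))
   + edge_e3 c t * (a * (a * a)))%pexpr.

(** The square and the cube of [a] are separate arguments, so that [abs_sqr] and [abs_cube] can
    replace products of [|a|]: these contain [PA 0] and would fail the syntactic smoothness test. *)
Definition edge_T {R : realType} (c : R) (t a2 a3 : pexpr R) : pexpr R :=
  (edge_t0 c t + edge_t2 c t * a2 + edge_t3 c t * a3)%pexpr.

Definition edge_v {R : realType} (c : R) (t a : pexpr R) : pexpr R :=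
  (t + (PC (3 * c ^+ 2 - 2) + PC (- (3 * c ^+ 2)) * t) * a)%pexpr.

Lemma patch_edge_frame (R : realType) (c : R) (t a u v : pexpr R) (x : 'rV[R]_2) :
  0 < c -> c < 1 ->
  peval u x = (4 - 3 * c ^+ 2) * peval a x ->
  peval v x = peval (edge_v c t a) x ->
  let N := edge_N c t a in let T := edge_T c t (a * a)%pexpr (a * (a * a))%pexpr in
  [/\ peval (patch_x c u v) x = peval (frame_x c N T) x,
      peval (patch_y c u v) x = peval (frame_y c t (a * a)) x &
      peval (patch_z c u v) x = peval (frame_z c N T) x].
Proof.
move=> c0 c1 ux vx N T; have h := sqr_lt1 _ _ c0 c1; have K0 := four_sub_gt0 _ _ h.
have K1 : 4 - 3 * c ^+ 2 != 0 by rewrite gt_eqF.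
have C1 : 1 - c ^+ 2 != 0 by rewrite gt_eqF// subr_gt0.
rewrite /N /T /= ux vx /=; clear N T ux vx.
by split; field; rewrite ?K1 ?C1 ?mulf_neq0.
Qed.

(** [N] measures the distance to the mirror and [T] a position inside it, so the reflection only
    negates [N]. *)
Lemma refl_frame (R : realType) (c : R) (N T : pexpr R) (x : 'rV[R]_2) :
  0 < c -> c < 1 ->
  peval (refl_x c (frame_x c N T) (frame_z c N T)) x =
    peval (frame_x c (PC (- 1) * N) T) x /\
  peval (refl_z c (frame_x c N T) (frame_z c N T)) x =
    peval (frame_z c (PC (- 1) * N) T) x.
Proof.
move=> c0 c1; have h := sqr_lt1 _ _ c0 c1; have K0 := four_sub_gt0 _ _ h.
have K1 : 4 - 3 * c ^+ 2 != 0 by rewrite gt_eqF.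
have C1 : 1 - c ^+ 2 != 0 by rewrite gt_eqF// subr_gt0.
have SS : Num.sqrt (1 - c ^+ 2) ^+ 2 = 1 - c ^+ 2 by rewrite sqr_sqrtr// subr_ge0 ltW.
rewrite /=; move: (Num.sqrt _) SS (peval N x) (peval T x) => S SS n t.
by split; field: SS; rewrite ?K1 ?C1 ?mulf_neq0.
Qed.

(** * Powers of the transversal parameter as functions of class C^2 *)

Section Chart.
Context {R : realType}.
Local Open Scope pexpr_scope.

(* The parameter [a] is taken to be [e1 (s - e2 s |s|)]; the following are
   [|a|], [a], [a^2], [|a|^3] and [a^3] as expressions in [s], [t], [|s|^3]. *)
Definition chart_abs (e1 e2 : pexpr R) : pexpr R :=
  e1 * (PA 0 + PC (- 1) * (e2 * (PV 0 * PV 0))).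

Definition chart_signed (e1 e2 : pexpr R) : pexpr R :=
  e1 * (PV 0 + PC (- 1) * (e2 * PA 1)).

Definition abs_sqr (e1 e2 : pexpr R) : pexpr R :=
  e1 * e1 * (PV 0 * PV 0 + PC (- 2) * (e2 * PA 2)
             + e2 * e2 * (PV 0 * PV 0 * (PV 0 * PV 0))).

Definition abs_cube (e1 e2 : pexpr R) : pexpr R :=
  e1 * (e1 * e1) *
  (PA 2 + PC (- 3) * (e2 * (PV 0 * PV 0 * (PV 0 * PV 0)))
   + PC 3 * (e2 * e2 * (PA 2 * (PV 0 * PV 0)))
   + PC (- 1) * (e2 * e2 * e2 * (PV 0 * PV 0 * (PV 0 * PV 0) * (PV 0 * PV 0)))).

Definition signed_cube (e1 e2 : pexpr R) : pexpr R :=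
  e1 * (e1 * e1) *
  (PV 0 * PV 0 * PV 0 + PC (- 3) * (e2 * (PV 0 * PA 2))
   + PC 3 * (e2 * e2 * (PV 0 * PV 0 * (PV 0 * PV 0) * PV 0))
   + PC (- 1) * (e2 * e2 * e2 * (PV 0 * PV 0 * PV 0 * PA 2))).

(* The reparametrization is chosen so that the term in [s |s|] cancels here. *)
Definition signed_N (e1 e2 e3 : pexpr R) : pexpr R :=
  PC 3 * (e1 * e1) * (PV 0 + PC (- 2) * (e2 * e2 * (PV 0 * PV 0 * PV 0))
                      + e2 * e2 * e2 * (PV 0 * PA 2))
  + e3 * signed_cube e1 e2.

(** Once the sign of [s] is fixed these are polynomial identities. In the last one the coefficient
    of [s |s|] is [- 3 e1^2 e2 + 3 e2 e1^2 = 0]. *)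
Lemma chart_powers (e1 e2 e3 : pexpr R) (x : 'rV[R]_2) :
  let a := peval (chart_abs e1 e2) x in
  let sg := if (0 <= x 0 0)%R then 1%R else (- 1)%R in
  [/\ peval (abs_sqr e1 e2) x = (a * a)%R,
      peval (abs_cube e1 e2) x = (a * (a * a))%R,
      peval (chart_signed e1 e2) x = (sg * a)%R &
      peval (signed_N e1 e2 e3) x =
      (sg * (3 * (peval e1 x * a) + 3 * (peval e2 x * (a * a))
             + peval e3 x * (a * (a * a))))%R].
Proof.
rewrite /=; case: (leP 0%R (x 0 0)) => s0.
  by rewrite ger0_norm//; split; ring.
by rewrite ltr0_norm//; split; ring.
Qed.

(** On the edge the even part is stationary while the distance to the mirror has slope [3 e1^2] in
    [s]; this gives regularity there. *)
Lemma chart_powers_der (e1 e2 e3 : pexpr R) (x : 'rV[R]_2) :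
  x 0 0 = 0%R ->
  [/\ peval (abs_sqr e1 e2) x = 0%R /\ peval (abs_cube e1 e2) x = 0%R,
      peval (signed_N e1 e2 e3) x = 0%R,
      (forall i, peval (pder i (abs_sqr e1 e2)) x = 0%R /\
                 peval (pder i (abs_cube e1 e2)) x = 0%R) &
      peval (pder 0 (signed_N e1 e2 e3)) x = (3 * (peval e1 x * peval e1 x))%R].
Proof.
move=> x0; split.
- by rewrite /= x0 normr0; split; ring.
- by rewrite /= x0; ring.
- by move=> i; split; rewrite /=; case: (i == 0); rewrite /= x0 normr0; ring.
- by rewrite /= x0 normr0; ring.
Qed.

End Chart.

(** * The edge chart and its inverse *)

Definition edge_a {R : realType} (c : R) : pexpr R :=
  chart_abs (edge_e1 c (PV 1)) (edge_e2 c (PV 1)).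

(** The first coordinate carries the sign of [s]; the second depends on [|a|] only, because the
    second patch is read through [flip]. *)
Definition edge_chart {R : realType} (c : R) (z : 'rV[R]_2) : 'rV[R]_2 :=
  vec2 (peval (PC (4 - 3 * c ^+ 2) *
               chart_signed (edge_e1 c (PV 1)) (edge_e2 c (PV 1)))%pexpr z)
       (peval (edge_v c (PV 1) (edge_a c)) z).

(* The inverse of the chart: [t] solves a linear equation, since
   [v = t + (3 c^2 - 2 - 3 c^2 t) |a|], and [s] the equation
   [s - e2 s |s| = a / e1], whose small root is [2 y / (1 + sqrt (1 - 4 e2 |y|))]
   for [y = a / e1]. *)
Definition edge_den {R : realType} (c : R) : pexpr R :=
  (PC 1 + PC (- (3 * c ^+ 2 / (4 - 3 * c ^+ 2))) * PA 0)%pexpr.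

Definition edge_time {R : realType} (c : R) (x : 'rV[R]_2) : R :=
  peval (PV 1 + PC (- ((3 * c ^+ 2 - 2) / (4 - 3 * c ^+ 2))) * PA 0)%pexpr x
  / peval (edge_den c) x.

(** The coefficients are functions of [t] alone, so 0 fills the place of [s]. *)
Definition edge_coef {R : realType} (c : R) (e : pexpr R) (x : 'rV[R]_2) : R :=
  peval e (vec2 0 (edge_time c x)).

Definition edge_ratio {R : realType} (c : R) (x : 'rV[R]_2) : R :=
  x 0 0 / ((4 - 3 * c ^+ 2) * edge_coef c (edge_e1 c (PV 1)) x).

Definition edge_disc {R : realType} (c : R) (x : 'rV[R]_2) : R :=
  1 - 4 * edge_coef c (edge_e2 c (PV 1)) x * `|edge_ratio c x|.

Definition edge_inv {R : realType} (c : R) (x : 'rV[R]_2) : 'rV[R]_2 :=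
  vec2 (2 * edge_ratio c x / (1 + Num.sqrt (edge_disc c x))) (edge_time c x).

Definition edge_target {R : realType} (c : R) : set 'rV[R]_2 :=
  [set x | [/\ regular_domain c x, 0 < peval (edge_den c) x,
               0 < edge_coef c (edge_e1 c (PV 1)) x & 0 < edge_disc c x]].

(** The second condition selects the small root of the quadratic equation for [s]; the last two say
    that the image has positive [edge_den] and lies in [regular_domain]. *)
Definition edge_source {R : realType} (c : R) : set 'rV[R]_2 :=
  [set z | [/\ 0 < peval (edge_e1 c (PV 1)) z,
     0 < peval (PC 1 + PC (- 2) * (edge_e2 c (PV 1) * PA 0))%pexpr z,
     0 < peval (PC 1 + PC (- (3 * c ^+ 2)) * edge_a c)%pexpr z &
     0 < peval (gap c (PC (4 - 3 * c ^+ 2) * edge_a c)%pexpr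
                 (edge_v c (PV 1) (edge_a c))) z]].

Lemma edge_vE (R : realType) (c : R) (t a : pexpr R) (x : 'rV[R]_2) :
  peval (edge_v c t a) x =
  peval t x + (3 * c ^+ 2 - 2 - 3 * c ^+ 2 * peval t x) * peval a x.
Proof. by rewrite /edge_v /=; ring. Qed.

Lemma chart_signedZE (R : realType) (k : R) (e1 e2 : pexpr R) (x : 'rV[R]_2) :
  peval (PC k * chart_signed e1 e2)%pexpr x =
  k * (peval e1 x * (x 0 0 - peval e2 x * (x 0 0 * `|x 0 0|))).
Proof. by rewrite /=; ring. Qed.

Lemma chart_absE (R : realType) (e1 e2 : pexpr R) (x : 'rV[R]_2) :
  peval (chart_abs e1 e2) x =
  peval e1 x * (`|x 0 0| - peval e2 x * (x 0 0 * x 0 0)).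
Proof. by rewrite /=; ring. Qed.

Lemma gapE (R : realType) (c : R) (u v u' v' : pexpr R) (x y : 'rV[R]_2) :
  peval u x = peval u' y -> peval v x = peval v' y ->
  peval (gap c u v) x = peval (gap c u' v') y.
Proof. by rewrite /gap /= => -> ->. Qed.

Lemma edge_denE (R : realType) (c : R) (x : 'rV[R]_2) :
  peval (edge_den c) x = 1 - 3 * c ^+ 2 / (4 - 3 * c ^+ 2) * `|x 0 0|.
Proof. by rewrite /= expr0; ring. Qed.

Lemma edge_source_open (R : realType) (c : R) : open (edge_source c).
Proof.
have -> : edge_source c =
  ([set z | 0 < peval (edge_e1 c (PV 1)) z]
  `&` [set z | 0 < peval (PC 1 + PC (- 2) * (edge_e2 c (PV 1) * PA 0))%pexpr z])
  `&` ([set z | 0 < peval (PC 1 + PC (- (3 * c ^+ 2)) * edge_a c)%pexpr z]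
  `&` [set z | 0 < peval (gap c (PC (4 - 3 * c ^+ 2) * edge_a c)%pexpr
                 (edge_v c (PV 1) (edge_a c))) z]).
  by apply/seteqP; split=> [z [? ? ? ?]|z [[? ?] [? ?]]]; split.
by do 2 apply: openI; exact: peval_open_pos.
Qed.

Lemma edge_target_continuous (R : realType) (c : R) (x : 'rV[R]_2) :
  0 < c -> c < 1 -> edge_target c x ->
  [/\ {for x, continuous (edge_coef c (edge_e1 c (PV 1)))},
      {for x, continuous (edge_disc c)} &
      {for x, continuous (edge_inv c)}].
Proof.
move=> c0 c1 [_ d0 e0 r0]; have h := sqr_lt1 _ _ c0 c1; have K0 := four_sub_gt0 _ _ h.
have ct : {for x, continuous (edge_time c)}.
  apply: continuousM; first exact: peval_continuous.
  by apply: continuousV; [rewrite gt_eqF|exact: peval_continuous].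
have cc e : {for x, continuous (edge_coef c e)}.
  apply: (@continuous_comp _ _ _ (fun y => vec2 0 (edge_time c y)) (peval e)).
    by apply: vec2_continuous => //; exact: cst_continuous.
  exact: peval_continuous.
have cr : {for x, continuous (edge_ratio c)}.
  apply: continuousM; first exact: (peval_continuous (PV 0)).
  apply: continuousV; first by rewrite gt_eqF// mulr_gt0.
  by apply: continuousM => //; exact: cst_continuous.
have cd : {for x, continuous (edge_disc c)}.
  apply: continuousB; first exact: cst_continuous.
  apply: continuousM.
    by apply: continuousM => //; exact: cst_continuous.
  apply: (@continuous_comp _ _ _ (edge_ratio c) Num.norm) => //.
  exact: (@norm_continuous R R^o _).
split=> //; apply: vec2_continuous => //.
apply: continuousM.
  by apply: continuousM => //; exact: cst_continuous.
apply: continuousV; first by rewrite gt_eqF// ltr_wpDr// sqrtr_ge0.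
apply: continuousD; first exact: cst_continuous.
apply: (@continuous_comp _ _ _ (edge_disc c) Num.sqrt) => //.
exact: sqrt_continuous.
Qed.

(** Continuity of the quotients is available only where their denominators are positive, so openness
    is checked at each point of the set. *)
Lemma edge_target_open (R : realType) (c : R) :
  0 < c -> c < 1 -> open (edge_target c).
Proof.
move=> c0 c1; rewrite openE => x tx.
have [ce cd _] := edge_target_continuous _ _ _ c0 c1 tx.
have [rx dx ex qx] := tx.
have H (f : 'rV[R]_2 -> R) : {for x, continuous f} -> 0 < f x ->
    nbhs x [set y | 0 < f y].
  move=> cf f0; apply: (cf [set r | 0 < r]).
  by apply: open_nbhs_nbhs; split=> //; exact: open_gt.
have n1 : nbhs x (regular_domain c).
  by apply: open_nbhs_nbhs; split=> //; exact: regular_domain_open.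
have n2 := H _ (peval_continuous (edge_den c) x) dx.
apply: filterS (filterI (filterI n1 n2) (filterI (H _ ce ex) (H _ cd qx))).
by move=> y [[? ?] [? ?]]; split.
Qed.

Lemma edge_invK (R : realType) (c : R) (x : 'rV[R]_2) :
  0 < c -> c < 1 -> edge_target c x -> edge_chart c (edge_inv c x) = x.
Proof.
move=> c0 c1 [_ d0]; have h := sqr_lt1 _ _ c0 c1; have K0 := four_sub_gt0 _ _ h.
have tE : edge_time c x * peval (edge_den c) x =
    x 0 1 - (3 * c ^+ 2 - 2) / (4 - 3 * c ^+ 2) * `|x 0 0|.
  by rewrite divfK ?gt_eqF//= expr0; ring.
rewrite /edge_disc; set y := edge_ratio c x.
have yE : y = x 0 0 / ((4 - 3 * c ^+ 2) * edge_coef c (edge_e1 c (PV 1)) x) by [].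
move: yE; rewrite /edge_inv -/y /edge_disc -/y.
rewrite /edge_chart /edge_coef.
have e1E (s t : R) : peval (edge_e1 c (PV 1)) (vec2 s t) =
   peval (edge_e1 c (PV 1)) (vec2 0 t) by rewrite /= !mxE.
have e2E (s t : R) : peval (edge_e2 c (PV 1)) (vec2 s t) =
   peval (edge_e2 c (PV 1)) (vec2 0 t) by rewrite /= !mxE.
set t := edge_time c x; set E1 := peval (edge_e1 _ _) _.
set E2 := peval (edge_e2 _ _) _; move=> yE E0 r0.
set q := Num.sqrt _; set s := 2 * y / (1 + q).
have q0 : 0 <= q by exact: sqrtr_ge0.
have q1 : 1 + q != 0 by rewrite gt_eqF// ltr_wpDr.
have qq : q ^+ 2 = 1 - 4 * E2 * `|y| by rewrite sqr_sqrtr// ltW.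
have sN : `|s| = 2 * `|y| / (1 + q).
  by rewrite /s normrM normfV normrM (ger0_norm (ler0n R 2))
    (ger0_norm (addr_ge0 ler01 q0)).
(* The difference of the two sides is a multiple of [1 - 4 E2 |y| - q^2], which vanishes by the
   choice of [q]. *)
have H1 : s - E2 * (s * `|s|) = y.
  rewrite sN /s; apply/eqP; rewrite -subr_eq0; apply/eqP.
  transitivity (y * (1 - 4 * E2 * `|y| - q ^+ 2) / (1 + q) ^+ 2); first by field.
  by rewrite qq subrr mulr0 mul0r.
have H2 : `|s| - E2 * (s * s) = `|y|.
  have -> : s * s = `|s| * `|s| by rewrite -normrM ger0_norm// -expr2 sqr_ge0.
  rewrite sN; apply/eqP; rewrite -subr_eq0; apply/eqP.
  transitivity (`|y| * (1 - 4 * E2 * `|y| - q ^+ 2) / (1 + q) ^+ 2); first by field.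
  by rewrite qq subrr mulr0 mul0r.
have K1 : 4 - 3 * c ^+ 2 != 0 by rewrite gt_eqF.
have EN : E1 != 0 by rewrite gt_eqF.
have aE : peval (edge_a c) (vec2 s t) = `|x 0 0| / (4 - 3 * c ^+ 2).
  rewrite /edge_a /chart_abs.
  transitivity (E1 * (`|s| - E2 * (s * s))).
    by rewrite chart_absE !vec2E e1E e2E.
  rewrite H2 yE normrM normfV normrM (gtr0_norm K0) (gtr0_norm E0).
  by field; rewrite K1 EN.
rewrite -[RHS]vec2_eta; congr vec2.
  transitivity ((4 - 3 * c ^+ 2) * (E1 * (s - E2 * (s * `|s|)))).
    by rewrite chart_signedZE !vec2E e1E e2E.
  by rewrite H1 yE; field; rewrite K1 EN.
transitivity (t * peval (edge_den c) x
    + (3 * c ^+ 2 - 2) * (`|x 0 0| / (4 - 3 * c ^+ 2))).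
  by rewrite edge_vE aE /= !mxE /= expr0; field.
by rewrite tE; field.
Qed.

Lemma edge_chartK (R : realType) (c : R) (z : 'rV[R]_2) :
  0 < c -> c < 1 -> edge_source c z ->
  edge_target c (edge_chart c z) /\ edge_inv c (edge_chart c z) = z.
Proof.
move=> c0 c1 [E0 q0 d0 g0]; have h := sqr_lt1 _ _ c0 c1; have K0 := four_sub_gt0 _ _ h.
have K1 : 4 - 3 * c ^+ 2 != 0 by rewrite gt_eqF.
move: E0 q0; set E1 := peval (edge_e1 c (PV 1)) z => E0.
set s := z 0 0; set E2 := peval (edge_e2 c (PV 1)) z => q0.
have {}q0 : 0 < 1 - 2 * E2 * `|s|.
  suff -> : 1 - 2 * E2 * `|s| = 1 + - 2 * (E2 * (s ^+ 0 * `|s|)) by exact: q0.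
  by rewrite expr0; ring.
(* This gives the image the sign of [s] in its first coordinate, and [|u| = K |a|]. *)
have H0 : 0 < 1 - E2 * `|s| by lra.
have EN : E1 != 0 by rewrite gt_eqF.
set x := edge_chart c z.
have x0 : x 0 0 = (4 - 3 * c ^+ 2) * (E1 * (s * (1 - E2 * `|s|))).
  rewrite /x /edge_chart vec2E (chart_signedZE) -/E1 -/E2 -/s.
  by congr (_ * (_ * _)); ring.
have aE : peval (edge_a c) z = E1 * (`|s| * (1 - E2 * `|s|)).
  have ss : s * s = `|s| * `|s| by rewrite -normrM ger0_norm// -expr2 sqr_ge0.
  by rewrite /edge_a chart_absE -/E1 -/E2 -/s ss; congr (_ * _); ring.
have nx : `|x 0 0| = (4 - 3 * c ^+ 2) * peval (edge_a c) z.
  by rewrite x0 aE !normrM (gtr0_norm K0) (gtr0_norm E0) (gtr0_norm H0).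
have x1 : x 0 1 = peval (edge_v c (PV 1) (edge_a c)) z by rewrite /x mxE.
have dE : peval (edge_den c) x = 1 - 3 * c ^+ 2 * peval (edge_a c) z.
  by rewrite edge_denE nx; field.
have {}d0 : 0 < 1 - 3 * c ^+ 2 * peval (edge_a c) z.
  by rewrite -mulNr; exact: d0.
have tE : edge_time c x = z 0 1.
  rewrite /edge_time dE; apply: (canLR (mulfK (negbT (gt_eqF d0)))).
  by rewrite [LHS]/= x1 nx edge_vE expr0 [peval (PV 1) z]/=; field.
have coefE e : (forall s t s', peval e (vec2 s t) = peval e (vec2 s' t)) ->
    edge_coef c e x = peval e z.
  by move=> he; rewrite /edge_coef tE -[in RHS](vec2_eta _ z) (he (z 0 0) _ 0).
have e1E : edge_coef c (edge_e1 c (PV 1)) x = E1.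
  by rewrite coefE// => ? ? ?; rewrite /= !mxE.
have e2E : edge_coef c (edge_e2 c (PV 1)) x = E2.
  by rewrite coefE// => ? ? ?; rewrite /= !mxE.
have rE : edge_ratio c x = s * (1 - E2 * `|s|).
  by rewrite /edge_ratio e1E x0; field; rewrite K1 EN.
(* The discriminant is a perfect square, and [1 - 2 E2 |s| > 0] determines its root. *)
have qE : edge_disc c x = (1 - 2 * E2 * `|s|) ^+ 2.
  by rewrite /edge_disc e2E rE normrM (gtr0_norm H0); ring.
split.
  split; rewrite ?dE ?e1E ?qE ?exprn_gt0//.
  rewrite /regular_domain /mkset.
  rewrite (_ : peval _ x = peval (gap c (PC (4 - 3 * c ^+ 2) * edge_a c)%pexpr
    (edge_v c (PV 1) (edge_a c))) z); first exact: g0.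
  by apply: gapE => //; rewrite [LHS]/= expr0 mul1r nx.
rewrite /edge_inv qE sqrtr_sqr (gtr0_norm q0) rE tE -[RHS]vec2_eta; congr vec2.
by rewrite -/s; field; rewrite gt_eqF//; lra.
Qed.

(** * The glued surface *)

Lemma frame_der (R : realType) (c : R) (i : 'I_2) (N T : pexpr R) (x : 'rV[R]_2) :
  peval (pder i (frame_x c N T)) x =
  c / (2 * (4 - 3 * c ^+ 2)) * (4 * peval (pder i N) x + peval (pder i T) x).
Proof. by rewrite /=; ring. Qed.

Lemma frame_y_der (R : realType) (c : R) (i : 'I_2) (a2 : pexpr R) (x : 'rV[R]_2) :
  peval a2 x = 0 -> peval (pder i a2) x = 0 ->
  peval (pder i (frame_y c (PV 1) a2)) x = Num.sqrt 3 * c * (i == 1)%:R.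
Proof. by move=> a0 d0; rewrite /= a0 d0; field. Qed.

Lemma edge_T_der (R : realType) (c : R) (a2 a3 : pexpr R) (x : 'rV[R]_2) :
  peval a2 x = 0 -> peval a3 x = 0 ->
  peval (pder 0 a2) x = 0 -> peval (pder 0 a3) x = 0 ->
  peval (pder 0 (edge_T c (PV 1) a2 a3)) x = 0.
Proof. by move=> a0 b0 d0 d1; rewrite /= a0 b0 d0 d1; ring. Qed.

Lemma eq_frame (R : realType) (c : R) (N T N' T' : pexpr R) (x : 'rV[R]_2) :
  peval N x = peval N' x -> peval T x = peval T' x ->
  peval (frame_x c N T) x = peval (frame_x c N' T') x /\
  peval (frame_z c N T) x = peval (frame_z c N' T') x.
Proof. by rewrite /frame_x /frame_z /= => -> ->. Qed.

Lemma eq_edge_T (R : realType) (c : R) (t a2 a3 b2 b3 : pexpr R) (x : 'rV[R]_2) :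
  peval a2 x = peval b2 x -> peval a3 x = peval b3 x ->
  peval (edge_T c t a2 a3) x = peval (edge_T c t b2 b3) x.
Proof. by rewrite /edge_T /= => -> ->. Qed.

Lemma eq_frame_y (R : realType) (c : R) (t a2 b2 : pexpr R) (x : 'rV[R]_2) :
  peval a2 x = peval b2 x ->
  peval (frame_y c t a2) x = peval (frame_y c t b2) x.
Proof. by rewrite /frame_y /= => ->. Qed.

Section Edge.
Context {R : realType} (c : R).

Definition glued_N : pexpr R :=
  signed_N (edge_e1 c (PV 1)) (edge_e2 c (PV 1)) (edge_e3 c (PV 1)).

Definition glued_a2 : pexpr R := abs_sqr (edge_e1 c (PV 1)) (edge_e2 c (PV 1)).

Definition glued_T : pexpr R :=
  edge_T c (PV 1) glued_a2 (abs_cube (edge_e1 c (PV 1)) (edge_e2 c (PV 1))).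

Definition glued_x : pexpr R := frame_x c glued_N glued_T.
Definition glued_y : pexpr R := frame_y c (PV 1) glued_a2.
Definition glued_z : pexpr R := frame_z c glued_N glued_T.

Definition glued_minor : pexpr R :=
  (pder 0 glued_x * pder 1 glued_y + PC (- 1) * (pder 0 glued_y * pder 1 glued_x))%pexpr.

Definition patch : 'rV[R]_2 -> 'rV[R]_3 :=
  pmap3 (patch_x c (PV 0) (PV 1)) (patch_y c (PV 0) (PV 1))
        (patch_z c (PV 0) (PV 1)).

(** On the edge [glued_y] and [glued_T] are stationary in [s], so the minor reduces to the product
    of the [s]-slope of [glued_x] and the [t]-slope of [glued_y], both positive. *)
Lemma glued_minor_gt0 (z : 'rV[R]_2) :
  0 < c -> c < 1 ->
  z 0 0 = 0 -> 0 < peval (edge_e1 c (PV 1)) z -> 0 < peval glued_minor z.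
Proof.
move=> c0 c1 z0 E0; have K0 := four_sub_gt0 _ _ (sqr_lt1 _ _ c0 c1).
have [[a2 a3] N0 da dN] := chart_powers_der (edge_e1 c (PV 1)) (edge_e2 c (PV 1))
  (edge_e3 c (PV 1)) z z0.
have [d20 d30] := da 0; have [d21 d31] := da 1.
have -> : peval glued_minor z =
    peval (pder 0 glued_x) z * peval (pder 1 glued_y) z
    + -1 * (peval (pder 0 glued_y) z * peval (pder 1 glued_x) z) by [].
rewrite !frame_y_der// frame_der dN edge_T_der// mulr1 mulr0 mul0r mulr0 !addr0.
by rewrite mulr_gt0 ?mulr_gt0 ?invr_gt0 ?mulr_gt0 ?sqrtr_gt0.
Qed.

Lemma patch_near_edge (z : 'rV[R]_2) (u v : R) :
  0 < c -> c < 1 ->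
  u = (4 - 3 * c ^+ 2) * peval (edge_a c) z ->
  v = peval (edge_v c (PV 1) (edge_a c)) z ->
  let a := edge_a c in
  let T := edge_T c (PV 1) (a * a)%pexpr (a * (a * a))%pexpr in
  let N := edge_N c (PV 1) a in
  patch (vec2 u v) =
  vec3 (peval (frame_x c N T) z) (peval (frame_y c (PV 1) (a * a)) z)
       (peval (frame_z c N T) z).
Proof.
move=> c0 c1 uE vE a T N.
have [<- <- <-] := patch_edge_frame R c (PV 1) (edge_a c) (PC u) (PC v) z c0 c1 uE vE.
by rewrite /patch /pmap3 /patch_x /patch_y /patch_z /= !vec2E.
Qed.

(** The chart preserves the sign of the first coordinate. For [s < 0], [flip] leads back to the
    point with parameter [|a|], and the reflection supplies the sign of [N] given by
    [chart_powers]. *)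
Lemma glue_edge_chart (z : 'rV[R]_2) :
  0 < c -> c < 1 ->
  edge_source c z ->
  pmap3 glued_x glued_y glued_z z =
  glue_patches patch (plane_reflection (vtx1 c) (vtx2 c) \o patch) (edge_chart c z).
Proof.
move=> c0 c1 hz; have [E0 q0 _ _] := hz.
have K0 := four_sub_gt0 _ _ (sqr_lt1 _ _ c0 c1).
have [A2 A3 As AN] := chart_powers (edge_e1 c (PV 1)) (edge_e2 c (PV 1))
  (edge_e3 c (PV 1)) z.
rewrite -/(edge_a c) in A2 A3 As AN.
set s := z 0 0 in As AN.
have q1 : 0 < 1 - peval (edge_e2 c (PV 1)) z * `|s|.
  suff : 0 < 1 - 2 * (peval (edge_e2 c (PV 1)) z * `|s|) by lra.
  suff -> : 1 - 2 * (peval (edge_e2 c (PV 1)) z * `|s|) =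
    1 + - 2 * (peval (edge_e2 c (PV 1)) z * (s ^+ 0 * `|s|)) by exact: q0.
  by rewrite expr0; ring.
have x0E : edge_chart c z 0 0 =
    (4 - 3 * c ^+ 2) * peval (edge_e1 c (PV 1)) z
    * (1 - peval (edge_e2 c (PV 1)) z * `|s|) * s.
  by rewrite /edge_chart vec2E chart_signedZE -/s; ring.
have x1E : edge_chart c z 0 1 = peval (edge_v c (PV 1) (edge_a c)) z.
  by rewrite /edge_chart vec2E.
have x0S : edge_chart c z 0 0 = (4 - 3 * c ^+ 2) *
    peval (chart_signed (edge_e1 c (PV 1)) (edge_e2 c (PV 1))) z.
  by rewrite /edge_chart vec2E.
have sgn : (0 <= edge_chart c z 0 0) = (0 <= s).
  by rewrite x0E pmulr_rge0// !mulr_gt0.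
rewrite /glue_patches sgn.
have eT : peval glued_T z = peval (edge_T c (PV 1) (edge_a c * edge_a c)%pexpr
   (edge_a c * (edge_a c * edge_a c))%pexpr) z by exact: eq_edge_T.
have ey : peval glued_y z = peval (frame_y c (PV 1) (edge_a c * edge_a c)%pexpr) z.
  exact: eq_frame_y.
have eN : peval (edge_N c (PV 1) (edge_a c)) z =
   3 * (peval (edge_e1 c (PV 1)) z * peval (edge_a c) z) +
   3 * (peval (edge_e2 c (PV 1)) z * (peval (edge_a c) z * peval (edge_a c) z)) +
   peval (edge_e3 c (PV 1)) z *
     (peval (edge_a c) z * (peval (edge_a c) z * peval (edge_a c) z)) by [].
case: (leP 0 s) As AN => s0 As AN.
  rewrite -[edge_chart c z]vec2_eta (patch_near_edge z) ?x0S ?As ?mul1r//.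
  rewrite /pmap3 ey; rewrite mul1r -eN in AN.
  by have [-> ->] := eq_frame _ c _ _ _ _ _ AN eT.
rewrite /= plane_reflectionE// /flip (patch_near_edge z) ?x0S ?As ?x1E//; last first.
  by rewrite mulN1r mulrN opprK.
rewrite /= !vec3E /pmap3 ey; rewrite -eN in AN.
have [rx rz] := refl_frame _ c (edge_N c (PV 1) (edge_a c)) (edge_T c (PV 1)
  (edge_a c * edge_a c)%pexpr (edge_a c * (edge_a c * edge_a c))%pexpr) z c0 c1.
have [-> ->] := eq_frame _ c _ _ (PC (- 1) * edge_N c (PV 1) (edge_a c))%pexpr _ _ AN eT.
by rewrite -rx -rz.
Qed.

End Edge.

Lemma glue_patches_Gk2 (R : realType) (c : R) :
  0 < c -> c < 1 ->
  Gk 2 (regular_domain c)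
    (glue_patches (patch c) (plane_reflection (vtx1 c) (vtx2 c) \o patch c)).
Proof.
move=> c0 c1 x Dx.
have oD := regular_domain_open R c.
have [x0|x0|x0] := ltgtP (x 0 0) 0.
(* Left of the edge the identity is a chart, with the reflected patch at [- u] as formula. *)
- pose u : pexpr R := (PC (- 1) * PV 0)%pexpr.
  pose U := [set z | 0 < peval u z] `&` regular_domain c.
  have oU : open U by apply: openI => //; exact: peval_open_pos.
  have Un z : U z -> z 0 0 < 0 by case; rewrite /u /= mulN1r oppr_gt0.
  apply: (local_reparametrization R 2 U U (regular_domain c) _
    (pmap3 (refl_x c (patch_x c u (PV 1)) (patch_z c u (PV 1)))
           (patch_y c u (PV 1))
           (refl_z c (patch_x c u (PV 1)) (patch_z c u (PV 1))))
    id id x x) => //.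
  + by split=> //=; rewrite mulN1r oppr_gt0.
  + by move=> z [].
  + by move=> z Uz; split; [exact: cvg_id|].
  + by move=> z Uz; split; [exact: cvg_id|].
  + move=> z /set_mem/Un z0; rewrite /= /glue_patches leNgt z0 /=.
    rewrite plane_reflectionE// /patch /pmap3 !vec3E /flip.
    by rewrite /= !vec2E !mulN1r.
  + by move=> B; exact: Ck_pmap3.
  + have := reflected_patch_regular R c c0 c1; rewrite -/u => H z Uz.
    apply: H; have [_] := Uz; rewrite /regular_domain /mkset.
    rewrite (gapE _ _ _ _ u (PV 1) _ z)//=.
    by rewrite expr0 mul1r mulN1r ltr0_norm// Un.
- pose U := [set z | 0 < peval (PV 0 : pexpr R) z] `&` regular_domain c.
  have oU : open U by apply: openI => //; exact: peval_open_pos.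
  apply: (local_reparametrization R 2 U U (regular_domain c) _ (patch c) id id x x) => //.
  + by move=> z [].
  + by move=> z Uz; split; [exact: cvg_id|].
  + by move=> z Uz; split; [exact: cvg_id|].
  + by move=> z /set_mem[/= z0 _]; rewrite /= /glue_patches ltW.
  + by move=> B; exact: Ck_pmap3.
  + move=> z Uz; apply: (patch_regular R c c0 c1).
    have [z0] := Uz; rewrite /regular_domain /mkset.
    rewrite (gapE _ _ _ _ (PV 0) (PV 1) _ z)//=.
    by rewrite expr0 mul1r gtr0_norm.
- pose U := [set z | 0 < peval (glued_minor c) z] `&` edge_source c.
  have oU : open U.
    by apply: openI; [exact: peval_open_pos|exact: edge_source_open].
  (* At [u = 0] the condition defining [regular_domain] is exactly [e1 > 0]. *)
  have e1x : 0 < peval (edge_e1 c (PV 1)) x.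
    by move: Dx; rewrite /regular_domain /= x0 expr0 normr0 mulr0 mul0r !add0r.
  have ax : peval (edge_a c) x = 0.
    by rewrite /edge_a chart_absE x0 normr0; ring.
  have Ux : U x.
    split; first exact: glued_minor_gt0.
    split => //.
    + rewrite (_ : peval _ x = 1) //.
      rewrite -[LHS]/(1 + - 2 * (peval (edge_e2 c (PV 1)) x * (x 0 0 ^+ 0 * `|x 0 0|))).
      by rewrite x0 normr0; ring.
    + rewrite (_ : peval _ x = 1) //.
      by rewrite -[LHS]/(1 + - (3 * c ^+ 2) * peval (edge_a c) x) ax; ring.
    + rewrite (gapE _ _ _ _ (PA 0) (PV 1) _ x)//.
        rewrite -[LHS]/((4 - 3 * c ^+ 2) * peval (edge_a c) x) ax /= x0 normr0.
        by ring.
      by rewrite edge_vE ax mulr0 addr0.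
  (* At [s = 0] the parameter [a] vanishes, so the chart fixes the points of the edge. *)
  have xE : edge_chart c x = x.
    rewrite /edge_chart edge_vE ax mulr0 addr0 -[RHS]vec2_eta; congr vec2.
    by rewrite chart_signedZE x0; ring.
  apply: (local_reparametrization R 2 U (edge_target c) (regular_domain c) _
    (pmap3 (glued_x c) (glued_y c) (glued_z c)) (edge_chart c) (edge_inv c) x x) => //.
  + exact: edge_target_open.
  + by move=> z [].
  + move=> z [_ Uz]; have [tz zK] := edge_chartK R c z c0 c1 Uz; split=> //.
    by apply: vec2_continuous; exact: peval_continuous.
  + move=> z tz; split; last exact: edge_invK.
    by have [] := edge_target_continuous R c z c0 c1 tz.
  + by move=> z /set_mem[_ Uz]; exact: glue_edge_chart.
  + by move=> B; exact: Ck_pmap3.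
  + apply: (regular_pmap3 _ _ _ _ _ (vec3 1 0 0) (vec3 0 1 0)) => // z [m0 _].
    cbv zeta; rewrite !dotE3 /pmap3 !vec3E !(mulr0, mulr1, addr0, add0r).
    rewrite -mulN1r gt_eqF//; exact: m0.
Qed.

Theorem mainTheorem3 (R : realType) (c : R) (hc0 : 0 < c) (hc1 : c < 1) :
  let alpha := (8 - 3 * c ^+ 2) / (3 * (4 - 3 * c ^+ 2)) in
  let beta := 4 / (3 * (4 - 3 * c ^+ 2)) in
  let gamma := Num.sqrt (1 - c ^+ 2) * (8 - 8 * c ^+ 2 + 3 * c ^+ 4)
               / (2 * (1 - c ^+ 2) * (4 - 3 * c ^+ 2)) in
  let p1 := cubic_patch c alpha beta gamma in
  let p2 := plane_reflection (vtx1 c) (vtx2 c) \o p1 in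
  Gk_spline_patch 2 p1 p2.
Proof.
move=> alpha beta gamma p1 p2.
have p1E : p1 = patch c by apply/funext; exact: cubic_patchE.
rewrite /p2 p1E; split=> [v _|].
  (* The boundary curve lies in the mirror plane and is therefore fixed by the reflection. *)
  have h := sqr_lt1 _ _ hc0 hc1; have K0 := four_sub_gt0 _ _ h.
  have K1 : 4 - 3 * c ^+ 2 != 0 by rewrite gt_eqF.
  have C1 : 1 - c ^+ 2 != 0 by rewrite gt_eqF// subr_gt0.
  have SS : Num.sqrt (1 - c ^+ 2) ^+ 2 = 1 - c ^+ 2.
    by rewrite sqr_sqrtr// subr_ge0 ltW.
  rewrite /= plane_reflectionE// /patch /pmap3 !vec3E /= !vec2E.
  move: (Num.sqrt _) SS => S SS.
  by congr vec3; field: SS; rewrite ?K1 ?C1 ?mulf_neq0.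
exists (regular_domain c); split; first exact: regular_domain_open.
  exact: triangle_regular_domain.
exact: glue_patches_Gk2.
Qed.
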